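(* Let $G$ be a connected weighted undirected graph on $n$ vertices, and let $P$, $P(\alpha)$, $D$, $\lambda_*=\lambda_*(0)$, $v_*=v_*(0)$, $\lambda_*(\alpha)$ be as defined in the context. For sufficiently small $\alpha$, in the case $\lambda_*<0$, the spectral gap $\gamma(P(\alpha))$ increases, and equivalently, the relaxation time $1/\gamma(P(\alpha))$ decreases, with respect to $\alpha$. If $\lambda_*>0$, then for sufficiently small $\alpha$ the necessary and sufficient condition for the decrease of the relaxation time is $$\frac{1}{n}(\underline{1}^T v_* )^2<\lambda_*\, v_*^T v_*.$$ In addition, one has the asymptotics $$\lambda_*(\alpha)=\lambda_*+\alpha\,\frac{\frac1n v_*^T\underline{1}\,\underline{1}^T v_*-\lambda_* v_*^T v_*}{v_*^T D v_*}+O(\alpha^2).$$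
   Context: $G$ is a connected weighted undirected graph with vertex set $\{1,\dots,n\}$ and symmetric weighted adjacency matrix $A=(a_{ij})$, where $a_{ij}>0$ is the weight of edge $(i,j)$ if $i\sim j$ and $a_{ij}=0$ otherwise (weighted self-loops are not excluded). $\underline{1}$ is the column vector of ones, $d=A\underline{1}$ is the vector of weighted degrees, $D=\mathrm{Diag}(d)$. The standard random walk has transition matrix $P=D^{-1}A$. For $\alpha\ge 0$ the random walk with jumps has transition matrix $P(\alpha)=(D+\alpha I)^{-1}\left(A+\frac{\alpha}{n}\underline{1}\,\underline{1}^T\right)$, so $P(0)=P$. The eigenvalues of $P(\alpha)$ are real and semi-simple and lie in $[-1,1]$. $\lambda_*(\alpha)$ denotes the maximum modulus eigenvalue of $P(\alpha)$ different from $+1$ and $-1$, and $v_*(\alpha)$ a corresponding eigenvector: $P(\alpha)v_*(\alpha)=\lambda_*(\alpha)v_*(\alpha)$. Write $\lambda_*=\lambda_*(0)$, $v_*=v_*(0)$. The spectral gap is $\gamma(P(\alpha))=1-|\lambda_*(\alpha)|$ and the relaxation time is $1/\gamma(P(\alpha))$.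
   Formalization: Assumes −1 is not an eigenvalue of P and λ_* is simple and the only one of its modulus, or that v_*(α) is right-continuous at 0; for λ_*>0, ''decrease'' means negative right derivative at 0, or strict decrease near 0 when the two sides of the condition differ. *)

(* Defs.v *)
From HB Require Import structures.
From mathcomp Require Import all_boot all_order all_algebra.
From mathcomp Require Import all_classical all_reals all_analysis.
Set Implicit Arguments.
Unset Strict Implicit.
Unset Printing Implicit Defensive.
Import Order.TTheory GRing.Theory Num.Theory.
Import numFieldNormedType.Exports.
Local Open Scope classical_set_scope.
Local Open Scope ring_scope.

Section JumpWalk.
Variables (R : realType) (n : nat).
Implicit Types (A M : 'M[R]_n) (u v : 'cV[R]_n) (a l : R) (f : R -> R).

(* A positive diagonal entry is a weighted self-loop. *)
Definition connected_weighted_graph A : Prop :=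
  [/\ A^T = A,
      forall i j, 0 <= A i j &
      forall i j, connect (fun x y => 0 < A x y) i j].

Definition ones : 'cV[R]_n := const_mx 1.

Definition degree_mx A : 'M[R]_n := diag_mx (A *m ones)^T.

Definition walk_mx A : 'M[R]_n := invmx (degree_mx A) *m A.

Definition jump_walk_mx A a : 'M[R]_n :=
  invmx (degree_mx A + a%:M) *m (A + (a / n%:R) *: (ones *m ones^T)).

Lemma jump_walk_mx0 A : jump_walk_mx A 0 = walk_mx A.
Proof. by rewrite /jump_walk_mx raddf0 addr0 mul0r scale0r addr0. Qed.

Definition dot u v : R := (u^T *m v) 0 0.

(* [eigenvalue] is defined with row vectors acting on the left; left and right
   spectra coincide.  Only real eigenvalues are considered: all eigenvalues of
   [jump_walk_mx A a] are real, for [A] connected and [0 <= a]. *)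
Definition max_modulus_nontrivial_eigenvalue M l : Prop :=
  [/\ eigenvalue M l, l != 1, l != -1 &
      forall mu, eigenvalue M mu -> mu != 1 -> mu != -1 -> `|mu| <= `|l|].

Definition right_eigenvector M l v : Prop := v != 0 /\ M *m v = l *: v.

(* [-1] is not an eigenvalue (for the walk on a connected graph: the graph is
   not bipartite), [l] is the only nontrivial eigenvalue of its modulus, and
   its eigenspace is a line. *)
Definition nondegenerate M l : Prop :=
  [/\ ~~ eigenvalue M (-1),
      forall mu, eigenvalue M mu -> mu != 1 -> `|mu| = `|l| -> mu = l &
      \rank (eigenspace M l) = 1%N].

Definition dominant_eigenpairs A (lam : R -> R) (vs : R -> 'cV[R]_n) : Prop :=
  forall a, 0 <= a ->
    max_modulus_nontrivial_eigenvalue (jump_walk_mx A a) (lam a) /\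
    right_eigenvector (jump_walk_mx A a) (lam a) (vs a).

(* In general the eigenpairs do not form a well-defined branch at [a = 0].
   If the graph is bipartite, the eigenvalue -1 of [walk_mx A] is excluded from
   the choice of [lam 0], but for small [a > 0] it becomes a nontrivial
   eigenvalue close to -1, so [lam a] does not tend to [lam 0].  If [lam 0] is
   multiple, an arbitrary eigenvector [vs 0] need not be a limit of
   eigenvectors for [lam a].  Hence either the data at 0 are nondegenerate (and
   then [vs] is an arbitrary choice), or the chosen [vs] is right-continuous at
   0 (and then [lam] is too, and [lam 0] may be multiple). *)
Definition regular_at0 A (lam : R -> R) (vs : R -> 'cV[R]_n) : Prop :=
  nondegenerate (walk_mx A) (lam 0) \/ vs a @[a --> 0^'+] --> vs 0.

Definition spectral_gap (lam : R -> R) a : R := 1 - `|lam a|.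

Definition relaxation_time (lam : R -> R) a : R := (spectral_gap lam a)^-1.

Definition increasing_near0 f : Prop :=
  exists2 eps, 0 < eps & forall a b, 0 <= a -> a < b -> b < eps -> f a < f b.

Definition decreasing_near0 f : Prop :=
  exists2 eps, 0 < eps & forall a b, 0 <= a -> a < b -> b < eps -> f b < f a.

Definition negative_right_derivative_at0 f : Prop :=
  exists2 t : R, t < 0 & (f a - f 0) / a @[a --> 0^'+] --> t.

End JumpWalk.

Arguments ones {R n}.

(* Main.v *)
Require Import Defs.
From HB Require Import structures.
From mathcomp Require Import all_boot all_order all_algebra.
From mathcomp Require Import all_classical all_reals all_analysis.
From mathcomp Require Import ring lra.
Set Implicit Arguments.
Unset Strict Implicit.
Unset Printing Implicit Defensive.
Import Order.TTheory GRing.Theory Num.Theory.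
Import numFieldNormedType.Exports.
Local Open Scope classical_set_scope.
Local Open Scope ring_scope.

(* An eigenpair of P(a) is a solution of (A + (a/n) 1 1^T) v = l (D + a I) v.
   Pairing the equations at two parameters a, b through the symmetric matrix A
   gives
     (l_b - l_a) v_a^T (D + a I) v_b
       = (b - a) (1/n (v_a^T 1) (1^T v_b) - l_b v_a^T v_b).
   If v_a tends to v_0, this yields the right derivative of l at 0 and, with
   both parameters near 0, strict monotonicity if that derivative is nonzero.
   It also shows that the first-order correction equation for the eigenvector is
   solvable; pairing v_a with the corrected vector gives the O(a^2) remainder.
   In the nondegenerate case, l_a tends to l_0 by compactness of [-2, 2], and
   bordering the pencil by (D v_0) (D v_0)^T makes it invertible, which provides
   rescaled eigenvectors that tend to v_0. *)

(** * Entrywise limits of matrices, determinants and adjugates *)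

Section EntrywiseConvergence.
Context {R : realType} {T : Type} {F : set_system T} {FF : Filter F}.

(** The filter is arbitrary: right neighbourhoods of 0, nonnegative neighbourhoods and products of
    filters all occur below. *)
Definition mx_cvg m n (M : T -> 'M[R]_(m, n)) (L : 'M[R]_(m, n)) : Prop :=
  forall i j, M x i j @[x --> F] --> L i j.

Lemma mx_cvg_cst m n (L : 'M[R]_(m, n)) : mx_cvg (fun=> L) L.
Proof. by move=> i j; exact: cvg_cst. Qed.

Lemma mx_cvgD m n (M N : T -> 'M[R]_(m, n)) L K :
  mx_cvg M L -> mx_cvg N K -> mx_cvg (fun x => M x + N x) (L + K).
Proof.
move=> ML NK i j; rewrite mxE; under eq_cvg do rewrite mxE.
by apply: cvgD; [exact: ML | exact: NK].
Qed.

Lemma mx_cvgZ m n (f : T -> R) (M : T -> 'M[R]_(m, n)) (l : R) L :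
  f x @[x --> F] --> l -> mx_cvg M L ->
  mx_cvg (fun x => f x *: M x) (l *: L).
Proof.
move=> fl ML i j; rewrite mxE; under eq_cvg do rewrite mxE.
by apply: cvgM => //; exact: ML.
Qed.

Lemma mx_cvgN m n (M : T -> 'M[R]_(m, n)) L :
  mx_cvg M L -> mx_cvg (fun x => - M x) (- L).
Proof.
move=> ML i j; rewrite mxE; under eq_cvg do rewrite mxE.
by apply: cvgN; exact: ML.
Qed.

Lemma mx_cvg_tr m n (M : T -> 'M[R]_(m, n)) L :
  mx_cvg M L -> mx_cvg (fun x => (M x)^T) L^T.
Proof.
by move=> ML i j; rewrite mxE; under eq_cvg do rewrite mxE; exact: ML.
Qed.

Lemma mx_cvgM m n p (M : T -> 'M[R]_(m, n)) (N : T -> 'M[R]_(n, p)) L K :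
  mx_cvg M L -> mx_cvg N K -> mx_cvg (fun x => M x *m N x) (L *m K).
Proof.
move=> ML NK i j; rewrite mxE; under eq_cvg do rewrite mxE.
apply: cvg_big => [|k _]; first exact: add_continuous.
by apply: cvgM; [exact: ML | exact: NK].
Qed.

Lemma cvg_det n (M : T -> 'M[R]_n) L :
  mx_cvg M L -> \det (M x) @[x --> F] --> \det L.
Proof.
move=> ML; apply: cvg_big => [|s _]; first exact: add_continuous.
apply: cvgM; first exact: cvg_cst.
by apply: cvg_big => [|i _]; [exact: mul_continuous | exact: ML].
Qed.

Lemma mx_cvg_adj n (M : T -> 'M[R]_n) L :
  mx_cvg M L -> mx_cvg (fun x => \adj (M x)) (\adj L).
Proof.
move=> ML i j; rewrite mxE; under eq_cvg do rewrite mxE.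
apply: cvgM; first exact: cvg_cst.
apply: cvg_det => k l; rewrite !mxE; under eq_cvg do rewrite !mxE.
exact: ML.
Qed.

Lemma cvg_dot n (u v : T -> 'cV[R]_n) U V :
  mx_cvg u U -> mx_cvg v V -> dot (u x) (v x) @[x --> F] --> dot U V.
Proof. by move=> uU vV; exact: (mx_cvgM (mx_cvg_tr uU) vV). Qed.

End EntrywiseConvergence.
Arguments mx_cvg {R T} F {m n} M L.

(** * Rank-one updates and the Fredholm alternative over a field *)

Section RankOneUpdates.
Context {F : fieldType}.

(** Both sides are the determinant of one bordered matrix, factored into block triangular matrices
    in two ways. *)
Lemma det_1B_rank1 n (v : 'cV[F]_n) (r : 'rV[F]_n) :
  \det (1%:M - v *m r) = 1 - (r *m v) 0 0.
Proof.
have e1 : block_mx 1%:M v r 1%:M =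
    block_mx 1%:M 0 r 1%:M *m block_mx 1%:M v 0 (1%:M - r *m v).
  by rewrite mulmx_block !(mul1mx, mulmx1, mul0mx, mulmx0, addr0) subrKC.
have e2 : block_mx 1%:M v r 1%:M =
    block_mx 1%:M v 0 1%:M *m block_mx (1%:M - v *m r) 0 r 1%:M.
  by rewrite mulmx_block !(mul1mx, mulmx1, mul0mx, mulmx0, addr0, add0r) subrK.
have := congr1 determinant (etrans (esym e1) e2).
rewrite !det_mulmx !(det_ublock, det_lblock) !det1 !(mul1r, mulr1) => <-.
by rewrite det_mx11 mxE [1%:M _ _]mxE mxE.
Qed.

(** A left kernel vector [u] of the sum, multiplied by [v], gives [u c = 0]. Hence [u] is in the
    left kernel of [S], so it is a multiple of [v^T], and [v^T c != 0] makes that multiple zero. *)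
Lemma det_add_kernel_rank1_neq0 n (S : 'M[F]_n) (v c : 'cV[F]_n) :
    S *m v = 0 -> (c^T *m v) 0 0 != 0 ->
    (forall u : 'rV_n, u *m S = 0 -> exists k, u = k *: v^T) ->
  \det (S + c *m c^T) != 0.
Proof.
move=> Sv cv kerS; apply/det0P => -[u u0].
rewrite mulmxDr => uS.
have uc : u *m c = 0.
  have /eqP := congr1 (mulmx^~ v) uS.
  rewrite /= mulmxDl mul0mx -!mulmxA Sv mulmx0 add0r.
  rewrite [c^T *m v]mx11_scalar mul_mx_scalar -scalemxAr scaler_eq0 (negPf cv).
  by move=> /eqP.
have [|k uE] := kerS u; first by move: uS; rewrite mulmxA uc mul0mx addr0.
move: uc u0; rewrite uE -scalemxAl => /matrixP/(_ 0 0).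
rewrite [LHS]mxE [RHS]mxE -[v^T *m c]trmxK [X in k * X]mxE trmx_mul trmxK.
move=> /eqP; rewrite mulf_eq0 (negPf cv) orbF => /eqP ->.
by rewrite scale0r eqxx.
Qed.

(** Fredholm alternative: [r^T] is in the row space of [S] once it annihilates the columns of
    [cokermx S], and these columns lie in the kernel of [S]. *)
Lemma sym_image_orth_kernel n (S : 'M[F]_n) (r : 'cV[F]_n) :
    S^T = S -> (forall u : 'cV_n, S *m u = 0 -> u^T *m r = 0) ->
  exists v, S *m v = r.
Proof.
move=> symS orthr.
have /submxP[w rE] : (r^T <= S)%MS.
  rewrite submxE; apply/eqP/trmx_inj; rewrite trmx_mul trmxK trmx0.
  apply/row_matrixP => i; rewrite row_mul row0.
  rewrite -tr_col; apply: orthr.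
  by rewrite colE mulmxA mulmx_coker mul0mx.
by exists w^T; rewrite -{1}symS -trmx_mul -rE trmxK.
Qed.

End RankOneUpdates.

(** * The symmetric pencil whose kernel vectors are the eigenvectors of the walk *)

Section Pencil.
Context {R : realType} {n : nat}.
Implicit Types (A : 'M[R]_n) (u v : 'cV[R]_n) (a b l m x : R).

Definition jump_adj A a : 'M[R]_n := A + (a / n%:R) *: (ones *m ones^T).
Definition jump_deg A a : 'M[R]_n := degree_mx A + a%:M.
Definition pencil A a x : 'M[R]_n := jump_adj A a - x *: jump_deg A a.

Lemma dotE u v : dot u v = \sum_i u i 0 * v i 0.
Proof. by rewrite /dot mxE; apply: eq_bigr => i _; rewrite mxE. Qed.

Lemma dotC u v : dot u v = dot v u.
Proof. by rewrite !dotE; apply: eq_bigr => i _; rewrite mulrC. Qed.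

Lemma dotDr u v w : dot u (v + w) = dot u v + dot u w.
Proof. by rewrite /dot mulmxDr mxE. Qed.

Lemma dotZr u l v : dot u (l *: v) = l * dot u v.
Proof. by rewrite /dot -scalemxAr mxE. Qed.

Lemma dotNr u v : dot u (- v) = - dot u v.
Proof. by rewrite /dot mulmxN mxE. Qed.

Lemma dot0r u : dot u 0 = 0.
Proof. by rewrite /dot mulmx0 mxE. Qed.

Lemma dotZl u l v : dot (l *: u) v = l * dot u v.
Proof. by rewrite dotC dotZr dotC. Qed.

Lemma dot_gt0 v : v != 0 -> 0 < dot v v.
Proof.
move=> v0; have v_ge0 i : 0 <= v i 0 * v i 0 by rewrite -expr2 sqr_ge0.
rewrite dotE lt_neqAle sumr_ge0 // andbT eq_sym; apply: contra v0 => /eqP.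
move=> /psumr_eq0P s0; apply/eqP/matrixP => i j; rewrite ord1 [RHS]mxE.
have /eqP := s0 (fun i _ => v_ge0 i) i isT.
by rewrite mulf_eq0 orbb => /eqP.
Qed.

Lemma dot_mul_sym (S : 'M[R]_n) u v :
  S^T = S -> dot (S *m u) v = dot u (S *m v).
Proof. by move=> symS; rewrite /dot trmx_mul symS mulmxA. Qed.

Lemma dot_ones_sqr u v :
  dot u ((ones *m ones^T) *m v) = dot u ones * dot ones v.
Proof.
rewrite /dot !mulmxA -mulmxA [X in (X *m _) 0 0]mx11_scalar mul_scalar_mx.
by rewrite mxE.
Qed.

Lemma tr_jump_deg A a : (jump_deg A a)^T = jump_deg A a.
Proof. by rewrite /jump_deg linearD /= tr_diag_mx tr_scalar_mx. Qed.

Lemma tr_jump_adj A a : A^T = A -> (jump_adj A a)^T = jump_adj A a.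
Proof.
by move=> symA; rewrite /jump_adj linearD linearZ /= symA trmx_mul trmxK.
Qed.

Lemma tr_pencil A a x : A^T = A -> (pencil A a x)^T = pencil A a x.
Proof.
move=> symA; rewrite /pencil linearB linearZ /= tr_jump_adj //.
by rewrite tr_jump_deg.
Qed.

Lemma jump_degE A a : jump_deg A a = diag_mx (\row_i ((A *m ones) i 0 + a)).
Proof.
apply/matrixP => i j; rewrite !mxE.
by case: (i == j); rewrite ?mulr1n ?mulr0n ?addr0.
Qed.

Lemma jump_degD A a b : jump_deg A b = jump_deg A a + (b - a)%:M.
Proof. by rewrite /jump_deg -addrA -raddfD subrKC. Qed.

Lemma jump_adjD A a b :
  jump_adj A b = jump_adj A a + ((b - a) / n%:R) *: (ones *m ones^T).
Proof. by rewrite /jump_adj -addrA -scalerDl -mulrDl subrKC. Qed.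

Lemma pencilE A a x v :
  pencil A a x *m v = jump_adj A a *m v - x *: (jump_deg A a *m v).
Proof. by rewrite mulmxBl scalemxAl. Qed.

Lemma pencil_ones A a : (0 < n)%N -> pencil A a 1 *m ones = 0.
Proof.
move=> n0; apply/eqP; rewrite pencilE scale1r subr_eq0; apply/eqP.
rewrite /jump_adj /jump_deg !mulmxDl.
congr (_ + _).
  apply/matrixP => i j; rewrite mul_diag_mx !mxE mulr1.
  by apply: eq_bigr => k _; rewrite !mxE.
rewrite -scalemxAl mul_scalar_mx -mulmxA.
have -> : (ones : 'cV[R]_n)^T *m ones = n%:R%:M.
  rewrite [LHS]mx11_scalar mxE; congr (_%:M).
  under eq_bigr do rewrite !mxE mulr1.
  by rewrite sumr_const card_ord.
by rewrite mul_mx_scalar scalerA divfK // pnatr_eq0 -lt0n.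
Qed.

Lemma pencil_two_point A a b l m u v :
    A^T = A -> pencil A a l *m u = 0 -> pencil A b m *m v = 0 ->
  (m - l) * dot u (jump_deg A a *m v) =
  (b - a) * (n%:R^-1 * (dot u ones * dot ones v) - m * dot u v).
Proof.
move=> symA /eqP; rewrite pencilE subr_eq0 => /eqP eu.
move=> /eqP; rewrite pencilE subr_eq0 => /eqP ev.
have := congr1 (dot u) ev.
rewrite (jump_adjD A a b) (jump_degD A a b).
rewrite (mulmxDl (jump_adj A a)) (mulmxDl (jump_deg A a)) dotDr.
rewrite -(dot_mul_sym _ _ (tr_jump_adj a symA)) eu dotZl.
rewrite (dot_mul_sym _ _ (tr_jump_deg A a)) -scalemxAl dotZr dot_ones_sqr.
rewrite mul_scalar_mx dotZr dotDr dotZr.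
set D := dot u _; set P := dot u ones * _; set q := dot u v.
move=> E.
have -> : (m - l) * D = m * (D + (b - a) * q) - l * D - m * ((b - a) * q).
  by ring.
by rewrite -E; ring.
Qed.

Lemma right_eigenvector_pencil A a l v :
  jump_deg A a \in unitmx ->
  right_eigenvector (jump_walk_mx A a) l v <->
  v != 0 /\ pencil A a l *m v = 0.
Proof.
move=> Du; rewrite /right_eigenvector /jump_walk_mx -/(jump_adj _ _).
rewrite -/(jump_deg _ _).
split=> -[v0 vl]; split=> //.
  rewrite pencilE scalemxAr -vl !mulmxA mulmxV // mul1mx subrr //.
move: vl => /eqP; rewrite pencilE subr_eq0 -mulmxA => /eqP ->.
by rewrite -scalemxAr mulmxA mulVmx // mul1mx.
Qed.

Lemma jump_walk_mxB A a x :
  jump_deg A a \in unitmx ->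
  jump_walk_mx A a - x%:M = invmx (jump_deg A a) *m pencil A a x.
Proof.
move=> Du; rewrite /pencil mulmxBr -scalemxAr mulVmx //.
by rewrite scalemx1.
Qed.

Lemma eigenvalue_pencil A a x :
  jump_deg A a \in unitmx ->
  eigenvalue (jump_walk_mx A a) x = (\det (pencil A a x) == 0).
Proof.
move=> Du; rewrite /eigenvalue /eigenspace kermx_eq0 row_free_unit.
rewrite jump_walk_mxB // unitmx_mul unitmx_inv Du /= unitmxE unitfE negbK //.
Qed.

(** The invertible factor [invmx (jump_deg A a)] does not change the rank, so the left kernel of the
    pencil is a line too. By symmetry of the pencil it contains [v^T]. *)
Lemma pencil_line A a l v :
    A^T = A -> jump_deg A a \in unitmx -> v != 0 -> pencil A a l *m v = 0 ->
    \rank (eigenspace (jump_walk_mx A a) l) = 1%N ->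
  forall u : 'rV_n, u *m pencil A a l = 0 -> exists k, u = k *: v^T.
Proof.
move=> symA Du v0 pv; rewrite /eigenspace jump_walk_mxB //.
rewrite mxrank_ker (eqmxMfull _ (_ : row_full _)); last first.
  by rewrite row_full_unit unitmx_inv.
rewrite -mxrank_ker => rk1 u up.
have vk : (v^T <= kermx (pencil A a l))%MS.
  by apply/sub_kermxP; rewrite -{1}(tr_pencil a l symA) -trmx_mul pv trmx0.
have rv : \rank v^T = 1%N.
  by rewrite mxrank_tr; apply/eqP; rewrite eqn_leq rank_leq_col lt0n mxrank_eq0.
have : (kermx (pencil A a l) <= v^T)%MS.
  by rewrite -(geq_leqif (mxrank_leqif_sup vk)) rk1 rv.
move=> /(submx_trans _) kv.
have /kv/submxP[k ->] : (u <= kermx (pencil A a l))%MS by apply/sub_kermxP.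
by exists (k 0 0); rewrite [k in LHS]mx11_scalar mul_scalar_mx.
Qed.

(* Since [B v = (l - x + k) c] for [B] the second matrix, the first matrix is
   [B (1 - v c^T / (l - x + k))]. *)
Lemma det_pencil_factor A a l x v (c := jump_deg A a *m v)
    (k := dot c v) :
    pencil A a l *m v = 0 -> l - x + k != 0 ->
  \det (pencil A a x) * (l - x + k) =
  \det (pencil A a x + c *m c^T) * (l - x).
Proof.
move=> pv s0; set s := l - x + k.
have Bv : (pencil A a x + c *m c^T) *m v = s *: c.
  rewrite mulmxDl -mulmxA [c^T *m v]mx11_scalar mul_mx_scalar -/(dot c v) -/k.
  move: pv => /eqP; rewrite !pencilE subr_eq0 => /eqP ->.
  by rewrite -scalerBl -scalerDl.
have pE : pencil A a x =
    (pencil A a x + c *m c^T) *m (1%:M - (s^-1 *: v) *m c^T).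
  rewrite mulmxBr mulmx1 mulmxA -scalemxAr Bv scalerA mulVf //.
  by rewrite scale1r addrK.
rewrite {1}pE det_mulmx det_1B_rank1 -scalemxAr mxE -/(dot c v) -/k.
have sx : l - x = (1 - s^-1 * k) * s.
  by rewrite mulrBl mul1r mulrAC mulVf // mul1r /s addrK.
by rewrite sx mulrA.
Qed.

End Pencil.

(** * Degrees, spectral bound and harmonic vectors of a connected graph *)

Section ConnectedWeightedGraph.
Context {R : realType} {n : nat} (A : 'M[R]_n).
Hypothesis hA : connected_weighted_graph A.
Implicit Types (u v : 'cV[R]_n) (a l : R).

Let symA : A^T = A. Proof. by case: hA. Qed.

Let A_sym i j : A i j = A j i. Proof. by rewrite -{1}symA mxE. Qed.

Let A_ge0 i j : 0 <= A i j. Proof. by case: hA. Qed.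

Let degE i : (A *m ones) i 0 = \sum_j A i j.
Proof. by rewrite mxE; apply: eq_bigr => j _; rewrite mxE mulr1. Qed.

Lemma connected_path_ind (P : 'I_n -> Prop) (i j : 'I_n) :
  P i -> (forall k q, 0 < A k q -> P k -> P q) -> P j.
Proof.
move=> + step; case: hA => _ _ /(_ i j) /connectP[p + ->].
by elim: p i => //= k p IHp i /andP[ik /IHp kp] Pi; apply/kp/(step i).
Qed.

(** No path leaves a vertex of degree zero, so connectedness would make it the only vertex. *)
Lemma degree_gt0 i : (1 < n)%N -> 0 < (A *m ones) i 0.
Proof.
move=> n1; rewrite lt_neqAle degE sumr_ge0 // andbT eq_sym.
apply/eqP => /psumr_eq0P/(_ _ _) Ai0.
have {}Ai0 j : A i j = 0 by apply: Ai0.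
have all_i j : j = i.
  by apply: (connected_path_ind (P := fun j => j = i)) => // k q /[swap] ->;
     rewrite Ai0 ltxx.
move: n1; rewrite -(card_ord n) ltnNge => /negP[].
by apply/card_le1_eqP => p q _ _; rewrite (all_i p) (all_i q).
Qed.

(** The disjunction deals with a single vertex without loop: its degree is 0 and only a positive [a]
    helps. This is used at [a = 1] before [1 < n] is known. *)
Lemma jump_degree_gt0 a i :
  0 <= a -> ((1 < n)%N || (0 < a)) -> 0 < (A *m ones) i 0 + a.
Proof.
move=> a0 /orP[n1|agt0]; first by rewrite ltr_wpDr // degree_gt0.
by rewrite ltr_wpDl // degE sumr_ge0.
Qed.

Lemma jump_deg_unit a :
  0 <= a -> ((1 < n)%N || (0 < a)) -> jump_deg A a \in unitmx.
Proof.
move=> a0 na; rewrite jump_degE unitmxE det_diag unitfE.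
by apply/prodf_neq0 => i _; rewrite mxE gt_eqF // jump_degree_gt0.
Qed.

Lemma dot_jump_deg_gt0 a v :
    0 <= a -> ((1 < n)%N || (0 < a)) -> v != 0 ->
  0 < dot v (jump_deg A a *m v).
Proof.
move=> a0 na v0; rewrite dotE.
have term_ge0 i : 0 <= v i 0 * (jump_deg A a *m v) i 0.
  rewrite jump_degE mul_diag_mx !mxE mulrCA -expr2 mulr_ge0 ?sqr_ge0 //.
  have := jump_degree_gt0 i a0 na; rewrite mxE; exact: ltW.
rewrite lt_neqAle sumr_ge0 // andbT eq_sym; apply: contra v0 => /eqP.
move=> /psumr_eq0P/(_ _ _) s0; apply/eqP/matrixP => i j; rewrite ord1 [RHS]mxE.
have /eqP := s0 (fun i _ => term_ge0 i) i isT.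
rewrite jump_degE mul_diag_mx mxE mxE mulrCA !mulf_eq0 orbb.
by rewrite gt_eqF ?jump_degree_gt0 //= => /eqP.
Qed.

(** Maximum principle: in the row [i] where [|v i 0|] is largest, the triangle inequality bounds the
    left side by the row sum of [jump_adj A a] times [|v i 0|], and this row sum is the diagonal
    entry of [jump_deg A a]. *)
Lemma eigenvalue_norm_le1 a l v :
    0 <= a -> ((1 < n)%N || (0 < a)) -> v != 0 -> pencil A a l *m v = 0 ->
  `|l| <= 1.
Proof.
move=> a0 na v0 pv.
have n0 : (0 < n)%N.
  by move: v0; case: n v {pv} => // v; rewrite flatmx0 eqxx.
pose i0 := Ordinal n0.
pose i := [arg max_(i > i0) `|v i 0|]%O.
have vmax j : `|v j 0| <= `|v i 0|.
  by rewrite /i; case: arg_maxP => // k _ /(_ j isT).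
have vi0 : 0 < `|v i 0|.
  rewrite lt_neqAle normr_ge0 andbT eq_sym; apply: contra v0 => /eqP vi0.
  apply/eqP/matrixP => j k; rewrite ord1 mxE; apply/eqP.
  by rewrite -normr_eq0 eq_le normr_ge0 andbT -vi0 vmax.
have di0 := jump_degree_gt0 i a0 na.
have adjE k : jump_adj A a i k = A i k + a / n%:R.
  by rewrite !mxE big_ord1 !mxE !mulr1.
have eqi : (jump_adj A a *m v) i 0 = (l *: (jump_deg A a *m v)) i 0.
  by move: pv => /eqP; rewrite pencilE subr_eq0 => /eqP ->.
have : `|l * ((A *m ones) i 0 + a) * v i 0| <= ((A *m ones) i 0 + a) * `|v i 0|.
  have -> : l * ((A *m ones) i 0 + a) * v i 0 = (jump_adj A a *m v) i 0.
    by rewrite eqi jump_degE mul_diag_mx !mxE mulrA.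
  rewrite mxE (le_trans (ler_norm_sum _ _ _)) //.
  have -> : (A *m ones) i 0 + a = \sum_j jump_adj A a i j.
    under eq_bigr do rewrite adjE.
    rewrite big_split /= degE sumr_const card_ord.
    rewrite -[(a / _) *+ _]mulr_natr divfK //.
    by rewrite pnatr_eq0 -lt0n.
  rewrite mulr_suml; apply: ler_sum => k _.
  have adj_ge0 : 0 <= jump_adj A a i k.
    by rewrite adjE addr_ge0 // divr_ge0 // ler0n.
  by rewrite normrM (ger0_norm adj_ge0) ler_wpM2l.
rewrite !normrM (gtr0_norm di0) -mulrA ger_pMl //.
by rewrite mulr_gt0.
Qed.

(** The Dirichlet energy of [v] vanishes, so [v] agrees at the ends of every edge, and connectedness
    propagates the value. *)
Lemma harmonic_constant v i :
  pencil A 0 1 *m v = 0 -> v = v i 0 *: ones.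
Proof.
move=> pv.
have energy : \sum_j \sum_k A j k * (v j 0 - v k 0) ^+ 2 = 0.
  have pv0 : dot v (pencil A 0 1 *m v) = 0 by rewrite pv dot0r.
  have E : \sum_j \sum_k A j k * (v j 0 * v k 0 - v j 0 ^+ 2) = 0.
    rewrite -[RHS]pv0 dotE; apply: eq_bigr => j _.
    rewrite pencilE scale1r jump_degE mul_diag_mx /jump_adj mul0r scale0r addr0.
    rewrite !mxE addr0 mulrBr mulrCA mulr_sumr mulr_suml -sumrB.
    by apply: eq_bigr => k _; rewrite mxE; ring.
  (* The second copy has its indices exchanged; with [A] symmetric, the two copies complete the
     square. *)
  transitivity (- (\sum_j \sum_k A j k * (v j 0 * v k 0 - v j 0 ^+ 2) +
                   \sum_k \sum_j A j k * (v j 0 * v k 0 - v j 0 ^+ 2))).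
    rewrite -big_split -sumrN; apply: eq_bigr => j _.
    rewrite -big_split -sumrN; apply: eq_bigr => k _ /=.
    by rewrite (A_sym k j); ring.
  by rewrite [X in _ + X]exchange_big E addr0 oppr0.
have term_ge0 j k : 0 <= A j k * (v j 0 - v k 0) ^+ 2.
  by rewrite mulr_ge0 ?sqr_ge0.
apply/matrixP => j k; rewrite ord1 !mxE mulr1.
apply: (connected_path_ind (P := fun j => v j 0 = v i 0)) => // p q Apq <-.
have rowp : \sum_k A p k * (v p 0 - v k 0) ^+ 2 = 0.
  by move/psumr_eq0P: energy => -> // k' _; apply: sumr_ge0.
have /eqP : A p q * (v p 0 - v q 0) ^+ 2 = 0.
  by move/psumr_eq0P: rowp => ->.
by rewrite mulf_eq0 gt_eqF //= sqrf_eq0 subr_eq0 => /eqP.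
Qed.

(** On one vertex every vector is a multiple of [ones], which forces the excluded eigenvalue 1; on
    none there is no nonzero vector. The parameter 1 is chosen because its degree matrix is
    invertible for every [n]. *)
Lemma dominant_eigenpairs_order (lam : R -> R) (vs : R -> 'cV[R]_n) :
  dominant_eigenpairs A lam vs -> (1 < n)%N.
Proof.
move=> /(_ 1 ler01)[[_ l1 _ _]].
move=> /(right_eigenvector_pencil _ _ (jump_deg_unit _ _)).
rewrite ler01 ltr01 orbT => /(_ isT isT) [v0 pv].
rewrite ltnNge; apply: contra l1 => n1.
have n0 : (0 < n)%N.
  move: v0; case: (posnP n) => // n0; move: (vs 1).
  by rewrite n0 => v; rewrite flatmx0 eqxx.
have [k vE] : exists k, vs 1 = k *: ones.
  exists (vs 1 (Ordinal n0) 0); apply/matrixP => i j.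
  rewrite ord1 !mxE mulr1; congr (vs 1 _ 0); apply: val_inj => /=.
  by apply/eqP; rewrite -leqn0 -ltnS (leq_trans (ltn_ord i)).
have := pencil_two_point symA pv (pencil_ones A 1 n0).
rewrite subrr mul0r vE => /eqP; rewrite mulf_eq0 subr_eq0 eq_sym => /orP[//|].
move: v0; rewrite vE dotZl mulf_eq0 scaler_eq0 => /norP[k0 o0].
by rewrite (negPf k0) gt_eqF // dot_jump_deg_gt0 // ltr01 orbT.
Qed.

End ConnectedWeightedGraph.

(** * Continuity of the pencil in both parameters *)

Section PencilLimits.
Context {R : realType} {n : nat} (A : 'M[R]_n).
Context {T : Type} {F : set_system T} {FF : Filter F}.

Lemma mx_cvg_scalar (f : T -> R) (a : R) :
  f t @[t --> F] --> a -> mx_cvg F (fun t => (f t)%:M : 'M[R]_n) a%:M.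
Proof.
move=> fa i j; rewrite mxE; under eq_cvg do rewrite mxE.
by case: (i == j); [exact: fa | exact: cvg_cst].
Qed.

Lemma mx_cvg_jump_deg (f : T -> R) (a : R) :
  f t @[t --> F] --> a ->
  mx_cvg F (fun t => jump_deg A (f t)) (jump_deg A a).
Proof.
by move=> fa; apply: mx_cvgD; [exact: mx_cvg_cst | exact: mx_cvg_scalar].
Qed.

Lemma mx_cvg_pencil (f g : T -> R) (a x : R) :
  f t @[t --> F] --> a -> g t @[t --> F] --> x ->
  mx_cvg F (fun t => pencil A (f t) (g t)) (pencil A a x).
Proof.
move=> fa gx; apply: mx_cvgD.
  apply: mx_cvgD; first exact: mx_cvg_cst.
  apply: mx_cvgZ; last exact: mx_cvg_cst.
  by apply: cvgM; [exact: fa | exact: cvg_cst].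
by apply: mx_cvgN; apply: mx_cvgZ => //; exact: mx_cvg_jump_deg.
Qed.

End PencilLimits.

(** * Expansion and monotonicity along a right-continuous eigenvector branch *)

Section ContinuousBranch.
Context {R : realType} {n : nat} (A : 'M[R]_n).
Context (lam : R -> R) (vs : R -> 'cV[R]_n).
Hypothesis hA : connected_weighted_graph A.
Hypothesis hlam : dominant_eigenpairs A lam vs.
Hypothesis vs_cvg : mx_cvg 0^'+ vs (vs 0).

Let n_gt1 : (1 < n)%N. Proof. exact: dominant_eigenpairs_order hA _ _ hlam. Qed.

Let na (a : R) : (1 < n)%N || (0 < a). Proof. by rewrite n_gt1. Qed.

Let symA : A^T = A. Proof. by case: hA. Qed.

Lemma dominant_pencil a : 0 <= a -> vs a != 0 /\ pencil A a (lam a) *m vs a = 0.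
Proof.
move=> a0; have [_] := hlam a0.
by move/right_eigenvector_pencil; apply; exact: jump_deg_unit.
Qed.

Lemma dominant_norm_le1 a : 0 <= a -> `|lam a| <= 1.
Proof.
by move=> a0; have [v0] := dominant_pencil a0; exact: eigenvalue_norm_le1.
Qed.

Lemma dominant0_norm_lt1 : `|lam 0| < 1.
Proof.
rewrite lt_neqAle dominant_norm_le1 // andbT eqr_norml ler01 andbT negb_or.
by have [[_ -> -> _] _] := hlam (lexx 0).
Qed.

Definition slope_num : R :=
  n%:R^-1 * (dot (vs 0) ones * dot ones (vs 0)) - lam 0 * dot (vs 0) (vs 0).

Definition slope : R := slope_num / dot (vs 0) (degree_mx A *m vs 0).

Local Notation deg0 := (jump_deg A 0).

Lemma jump_deg0 : deg0 = degree_mx A.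
Proof. by rewrite /jump_deg raddf0 addr0. Qed.

Lemma slope_den_gt0 : 0 < dot (vs 0) (deg0 *m vs 0).
Proof.
by apply: (dot_jump_deg_gt0 hA) => //; have [] := dominant_pencil (lexx 0).
Qed.

(* The nonnegative reals near 0, with 0 itself, since the monotonicity claims
   also compare with [lam 0]. *)
Let F : set_system R := within [set a : R | 0 <= a] (nbhs (0 : R)).

Let FF : Filter F. Proof. exact: within_filter. Qed.

#[local] Existing Instance FF.

Let F_id : a @[a --> F] --> (0 : R).
Proof. by apply: cvg_within. Qed.

Let F_ge0 : \forall a \near F, 0 <= a.
Proof. exact: withinT. Qed.

Let F_vs : mx_cvg F vs (vs 0).
Proof.
move=> i j U Uv; have := vs_cvg Uv.
rewrite /F !near_simpl !near_withinE => nU.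
near=> a => /=; rewrite le_eqVlt => /predU1P[<-|a0].
  exact: nbhs_singleton.
by move: a0; near: a.
Unshelve. all: by end_near. Qed.

Let cvg_fixed_dot (u : 'cV[R]_n) (S : 'M[R]_n) :
  dot u (S *m vs a) @[a --> F] --> dot u (S *m vs 0).
Proof.
apply: cvg_dot; first exact: mx_cvg_cst.
by apply: mx_cvgM; [exact: mx_cvg_cst | exact: F_vs].
Qed.

Let cvg_num (u : 'cV[R]_n) :
  n%:R^-1 * (dot u ones * dot ones (vs a)) @[a --> F] -->
  n%:R^-1 * (dot u ones * dot ones (vs 0)).
Proof.
apply: cvgM; first exact: cvg_cst.
apply: cvgM; first exact: cvg_cst.
by apply: cvg_dot; [exact: mx_cvg_cst | exact: F_vs].
Qed.

Let two_point0 u a : 0 <= a -> pencil A 0 (lam 0) *m u = 0 ->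
  (lam a - lam 0) * dot u (deg0 *m vs a) =
  a * (n%:R^-1 * (dot u ones * dot ones (vs a)) - lam a * dot u (vs a)).
Proof.
move=> a0 pu; have [_ pa] := dominant_pencil a0.
by rewrite (pencil_two_point symA pu pa) subr0.
Qed.

(** The two-point identity at 0 and [a] is linear in [lam a]. Solving it gives [lam a = N a / Dn a],
    where the right side depends on [a] and [vs a] only. *)
Lemma lam_cvg : lam a @[a --> F] --> lam 0.
Proof.
have [_ p0] := dominant_pencil (lexx 0).
pose N a := lam 0 * dot (vs 0) (deg0 *m vs a) +
  a * (n%:R^-1 * (dot (vs 0) ones * dot ones (vs a))).
pose Dn a := dot (vs 0) (deg0 *m vs a) + a * dot (vs 0) (vs a).
have Dn_cvg : Dn a @[a --> F] --> dot (vs 0) (deg0 *m vs 0).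
  rewrite -[X in _ --> X]addr0 -[X in _ + X](mul0r (dot (vs 0) (vs 0))).
  apply: cvgD; first exact: cvg_fixed_dot.
  apply: cvgM; first exact: F_id.
  by apply: cvg_dot; [exact: mx_cvg_cst | exact: F_vs].
have N_cvg : N a @[a --> F] --> lam 0 * dot (vs 0) (deg0 *m vs 0).
  rewrite -[X in _ --> X]addr0 -[X in _ + X](mul0r (n%:R^-1 *
    (dot (vs 0) ones * dot ones (vs 0)))).
  apply: cvgD; last by apply: cvgM; [exact: F_id | exact: cvg_num].
  by apply: cvgM; [exact: cvg_cst | exact: cvg_fixed_dot].
have nz : dot (vs 0) (deg0 *m vs 0) != 0 by rewrite gt_eqF ?slope_den_gt0.
have <- : lam 0 * dot (vs 0) (deg0 *m vs 0) / dot (vs 0) (deg0 *m vs 0) = lam 0.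
  by rewrite mulfK.
apply: cvg_trans (cvgM N_cvg (cvgV nz Dn_cvg)); apply: near_eq_cvg.
have Dnz : \forall a \near F, Dn a != 0 by exact: cvgr_neq0 Dn_cvg nz.
near=> a.
have a0 : 0 <= a by near: a.
have Da : Dn a != 0 by near: a.
apply: (mulIf Da); rewrite divfK //.
have := two_point0 a0 p0; rewrite /N /Dn => E.
apply/eqP; rewrite -subr_eq0; apply/eqP.
move/eqP: E; rewrite -subr_eq0 => /eqP E.
by rewrite -[RHS]oppr0 -[X in _ = - X]E; ring.
Unshelve. all: by end_near. Qed.

Let cvg_right (f : R -> R) (l : R) :
  f a @[a --> F] --> l -> f a @[a --> 0^'+] --> l.
Proof.
apply: cvg_trans; apply: cvg_app; apply: within_subset => a.
exact: ltW.
Qed.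

Lemma lam_cvg_right : lam a @[a --> 0^'+] --> lam 0.
Proof. exact: cvg_right lam_cvg. Qed.

(** Here [u] ranges over the whole kernel at 0: [u = vs 0] gives the slope, and the other kernel
    vectors give the solvability condition when [lam 0] is multiple. *)
Let cvg_pencil_slope u : pencil A 0 (lam 0) *m u = 0 ->
  (lam a - lam 0) / a * dot u (deg0 *m vs a) @[a --> 0^'+] -->
  n%:R^-1 * (dot u ones * dot ones (vs 0)) - lam 0 * dot u (vs 0).
Proof.
move=> pu; apply: (@cvg_trans _
    ((fun a => n%:R^-1 * (dot u ones * dot ones (vs a)) - lam a * dot u (vs a))
       @ 0^'+)).
  apply: near_eq_cvg; near=> a.
  have a0 : 0 < a by near: a; exact: nbhs_right_gt.
  rewrite mulrAC two_point0 ?(ltW a0) // [a * _]mulrC mulfK // gt_eqF //.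
apply: cvg_right; apply: cvgB; first exact: cvg_num.
apply: cvgM; first exact: lam_cvg.
by apply: cvg_dot; [exact: mx_cvg_cst | exact: F_vs].
Unshelve. all: by end_near. Qed.

Lemma slope_cvg : (lam a - lam 0) / a @[a --> 0^'+] --> slope.
Proof.
have [_ p0] := dominant_pencil (lexx 0).
have nz : dot (vs 0) (deg0 *m vs 0) != 0 by rewrite gt_eqF ?slope_den_gt0.
have den_cvg := cvg_right (@cvg_fixed_dot (vs 0) deg0).
rewrite /slope -jump_deg0.
apply: cvg_trans (cvgM (cvg_pencil_slope p0) (cvgV nz den_cvg)).
have den_nz : \forall a \near 0^'+, dot (vs 0) (deg0 *m vs a) != 0.
  exact: cvgr_neq0 den_cvg nz.
by apply: near_eq_cvg; near=> a; apply: mulfK; near: a.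
Unshelve. all: by end_near. Qed.

(** The coefficient of [a] in [pencil A a (lam 0 + a * slope)]. *)
Let first_order : 'M[R]_n :=
  n%:R^-1 *: (ones *m ones^T) - (lam 0)%:M - slope *: deg0.

Let dot_first_order u : dot u (first_order *m vs 0) =
  n%:R^-1 * (dot u ones * dot ones (vs 0)) - lam 0 * dot u (vs 0)
  - slope * dot u (deg0 *m vs 0).
Proof.
rewrite /first_order; move: deg0 => D0.
rewrite !mulmxDl !mulNmx !dotDr !dotNr -!scalemxAl.
by rewrite mul_scalar_mx !dotZr dot_ones_sqr.
Qed.

(* The solvability condition for the first-order term of the eigenvector.  It
   holds even when [lam 0] is multiple, because [vs 0] is a limit. *)
Let first_order_orth u : pencil A 0 (lam 0) *m u = 0 ->
  dot u (first_order *m vs 0) = 0.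
Proof.
move=> pu; rewrite dot_first_order; apply/eqP; rewrite subr_eq0; apply/eqP.
apply: (cvg_unique (@Rhausdorff R) (cvg_pencil_slope pu)).
by apply: cvgM; [exact: slope_cvg | exact: cvg_right (@cvg_fixed_dot u deg0)].
Qed.

Lemma lam_second_order : exists2 k, 0 < k &
  \forall a \near 0^'+, `|lam a - (lam 0 + a * slope)| <= k * `|a ^+ 2|.
Proof.
have [_ p0] := dominant_pencil (lexx 0).
have [v1 v1E] : exists v1, pencil A 0 (lam 0) *m v1 = first_order *m vs 0.
  apply: sym_image_orth_kernel; first exact: tr_pencil.
  move=> u pu; apply/matrixP => i j.
  by rewrite !ord1 [RHS]mxE; exact: first_order_orth.
(* An approximate eigenvector: the choice of [v1] cancels the terms of order [a], and [z a] is the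
   residual divided by [a ^+ 2]. *)
pose x a := vs 0 - a *: v1.
pose z a := (a * slope) *: v1 - slope *: vs 0 - first_order *m v1.
have residual a : pencil A a (lam 0 + a * slope) *m x a = a ^+ 2 *: z a.
  have -> : pencil A a (lam 0 + a * slope) =
      pencil A 0 (lam 0) + a *: first_order - (a ^+ 2 * slope)%:M.
    apply/matrixP => i j; rewrite !mxE.
    by case: (i == j); rewrite ?mulr1n ?mulr0n; ring.
  rewrite /x /z; move: (pencil _ _ _) first_order p0 v1E => S C Sv Sv1.
  rewrite mulmxBr !mulmxDl !mulNmx Sv -!scalemxAr Sv1.
  rewrite -!scalemxAl !mul_scalar_mx.
  move: (C *m vs 0) (C *m v1) => w w1.
  by apply/matrixP => i j; rewrite !mxE; ring.
pose G a := dot (vs a) (jump_deg A a *m x a).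
pose H a := dot (vs a) (z a).
(* Pair the residual with [vs a] and move the symmetric pencil onto [vs a]: only the error in the
   eigenvalue survives. *)
have GH a : 0 <= a -> (lam a - (lam 0 + a * slope)) * G a = a ^+ 2 * H a.
  move=> a0; have [_ pa] := dominant_pencil a0.
  rewrite /H -(dotZr _ (a ^+ 2)) -residual.
  rewrite -(dot_mul_sym _ _ (tr_pencil _ _ symA)).
  have -> : pencil A a (lam 0 + a * slope) =
      pencil A a (lam a) + (lam a - (lam 0 + a * slope)) *: jump_deg A a.
    by rewrite /pencil scalerBl; apply/matrixP => i j; rewrite !mxE; ring.
  rewrite mulmxDl pa add0r -scalemxAl dotZl; congr (_ * _).
  by rewrite /G (dot_mul_sym _ _ (tr_jump_deg _ _)).
have x_cvg : mx_cvg F x (vs 0).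
  rewrite -[vs 0]subr0 -(scale0r v1).
  apply: mx_cvgD; first exact: mx_cvg_cst.
  by apply: mx_cvgN; apply: mx_cvgZ; [exact: F_id | exact: mx_cvg_cst].
have G_cvg : G a @[a --> 0^'+] --> dot (vs 0) (deg0 *m vs 0).
  apply: cvg_right; apply: cvg_dot; first exact: F_vs.
  by apply: mx_cvgM; [apply: mx_cvg_jump_deg; exact: F_id | exact: x_cvg].
have z_cvg : mx_cvg F z (z 0).
  apply: mx_cvgD; last exact: mx_cvg_cst.
  apply: mx_cvgD; last exact: mx_cvg_cst.
  apply: mx_cvgZ; last exact: mx_cvg_cst.
  by apply: cvgM; [exact: F_id | exact: cvg_cst].
have H_cvg : H a @[a --> 0^'+] --> H 0.
  by apply: cvg_right; apply: cvg_dot; [exact: F_vs | exact: z_cvg].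
have nz : dot (vs 0) (deg0 *m vs 0) != 0 by rewrite gt_eqF ?slope_den_gt0.
pose q := H 0 / dot (vs 0) (deg0 *m vs 0).
have HG_cvg : H a / G a @[a --> 0^'+] --> q.
  exact: cvgM H_cvg (cvgV nz G_cvg).
have q1 : `|q| < `|q| + 1 by rewrite ltrDl.
have HG_le : \forall a \near 0^'+, `|H a / G a| <= `|q| + 1.
  exact: cvgr_norm_le HG_cvg _ q1.
have G_nz : \forall a \near 0^'+, G a != 0 by exact: cvgr_neq0 G_cvg nz.
exists (`|q| + 1); first by rewrite ltr_wpDl.
near=> a.
have a0 : 0 < a by near: a; exact: nbhs_right_gt.
have Ga : G a != 0 by near: a.
have -> : lam a - (lam 0 + a * slope) = (H a / G a) * a ^+ 2.
  by apply: (mulIf Ga); rewrite GH ?ltW // [RHS]mulrAC divfK // mulrC.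
by rewrite normrM ler_wpM2r //; near: a.
Unshelve. all: by end_near. Qed.

Let F_eps (P : R -> Prop) : (\forall a \near F, P a) ->
  exists2 eps, 0 < eps & forall a, 0 <= a -> a < eps -> P a.
Proof.
rewrite /F near_withinE => /nbhs_ballP[e /= e0 eP].
exists e => // a a0 ae; apply: eP => //=.
by rewrite /ball /= sub0r normrN ger0_norm.
Qed.

Lemma lam_monotone : slope_num != 0 -> exists2 eps, 0 < eps &
  forall a b, 0 <= a -> a < b -> b < eps -> 0 < (lam b - lam a) * slope_num.
Proof.
move=> num0.
(* Under the product filter the signs of [G] and [N] hold for all pairs of parameters near 0 at
   once, which a derivative at 0 alone would not give. *)
pose F2 := filter_prod F F.
have fstF : p.1 @[p --> F2] --> F by exact: cvg_fst.
have sndF : p.2 @[p --> F2] --> F by exact: cvg_snd.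
have vs1 : mx_cvg F2 (fun p => vs p.1) (vs 0).
  by move=> i j; apply: (cvg_comp _ (fun a => vs a i j) fstF); exact: F_vs.
have vs2 : mx_cvg F2 (fun p => vs p.2) (vs 0).
  by move=> i j; apply: (cvg_comp _ (fun a => vs a i j) sndF); exact: F_vs.
pose G p := dot (vs p.1) (jump_deg A p.1 *m vs p.2).
pose N p := n%:R^-1 * (dot (vs p.1) ones * dot ones (vs p.2))
  - lam p.2 * dot (vs p.1) (vs p.2).
have G_cvg : G p @[p --> F2] --> dot (vs 0) (deg0 *m vs 0).
  apply: cvg_dot => //; apply: mx_cvgM => //; apply: mx_cvg_jump_deg.
  exact: cvg_comp fstF F_id.
have N_cvg : N p * slope_num @[p --> F2] --> slope_num * slope_num.
  apply: cvgM; last exact: cvg_cst.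
  apply: cvgB.
    apply: cvgM; first exact: cvg_cst.
    by apply: cvgM; apply: cvg_dot => //; exact: mx_cvg_cst.
  by apply: cvgM; [exact: cvg_comp sndF lam_cvg | exact: cvg_dot].
have num2 : 0 < slope_num * slope_num by rewrite -expr2 exprn_even_gt0.
have G_gt0 : \forall p \near F2, 0 < G p.
  exact: cvgr_gt G_cvg _ slope_den_gt0.
have N_gt0 : \forall p \near F2, 0 < N p * slope_num.
  exact: cvgr_gt N_cvg _ num2.
have [[P Q] /= [FP FQ] PQ] := filterI G_gt0 N_gt0.
have [eps eps0 PQeps] := F_eps (filterI FP FQ).
exists eps => // a b a0 ab be.
have b0 : 0 <= b := le_trans a0 (ltW ab).
have [_ pa] := dominant_pencil a0; have [_ pb] := dominant_pencil b0.
have [Ga Na] : 0 < G (a, b) /\ 0 < N (a, b) * slope_num.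
  by apply: PQ; split; [apply: (PQeps a _ _).1 => //; exact: lt_trans be
                       | apply: (PQeps b _ _).2].
rewrite -(pmulr_lgt0 _ Ga) mulrAC (pencil_two_point symA pa pb) -mulrA.
by rewrite mulr_gt0 ?subr_gt0.
Qed.

Let num_sqrE : slope_num =
  n%:R^-1 * dot ones (vs 0) ^+ 2 - lam 0 * dot (vs 0) (vs 0).
Proof. by rewrite /slope_num (dotC (vs 0) ones) expr2. Qed.

Let slope_sign : (slope < 0) = (slope_num < 0).
Proof. by rewrite /slope -jump_deg0 pmulr_llt0 // invr_gt0 slope_den_gt0. Qed.

(** For negative [lam 0] the numerator of the slope is a nonnegative square term plus a positive
    one, so [lam] increases while staying negative and its modulus shrinks. *)
Lemma gap_increasing_neg : lam 0 < 0 ->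
  increasing_near0 (spectral_gap lam) /\
  decreasing_near0 (relaxation_time lam).
Proof.
move=> l0.
have num_gt0 : 0 < slope_num.
  have mean_ge0 : 0 <= n%:R^-1 * dot ones (vs 0) ^+ 2.
    by apply: mulr_ge0; [rewrite invr_ge0 ler0n | exact: sqr_ge0].
  rewrite num_sqrE ltr_wpDl //.
  rewrite -mulNr mulr_gt0 ?oppr_gt0 // dot_gt0 //.
  by have [] := dominant_pencil (lexx 0).
have num0 : slope_num != 0 by rewrite gt_eqF.
have [e1 e1_gt0 mono] := lam_monotone num0.
have l_neg : \forall a \near F, lam a < 0 by exact: cvgr_lt lam_cvg _ l0.
have l_lt1 : \forall a \near F, `|lam a| < 1.
  exact: cvgr_norm_lt lam_cvg _ dominant0_norm_lt1.
have [e2 e2_gt0 small] := F_eps (filterI l_neg l_lt1).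
(* Positivity of the gap is carried along because inversion reverses the order only between positive
   numbers. *)
have key a b : 0 <= a -> a < b -> b < Num.min e1 e2 ->
    0 < spectral_gap lam a /\ spectral_gap lam a < spectral_gap lam b.
  rewrite lt_min => a0 ab /andP[b1 b2].
  have [la la1] := small a a0 (lt_trans ab b2).
  have [lb lb1] := small b (le_trans a0 (ltW ab)) b2.
  split; first by rewrite /spectral_gap subr_gt0.
  rewrite /spectral_gap !ltr0_norm // !opprK ltrD2l -subr_gt0.
  by have := mono a b a0 ab b1; rewrite pmulr_lgt0.
have e_gt0 : 0 < Num.min e1 e2 by rewrite lt_min e1_gt0.
split; exists (Num.min e1 e2) => // a b a0 ab be;
  have [ga gab] := key _ _ a0 ab be.
  by [].
by rewrite /relaxation_time ltf_pV2 // posrE // (lt_trans ga).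
Qed.

(** Near 0 the relaxation time is [(1 - lam a)^-1], so its right derivative is the slope over a
    positive square. With a nonzero numerator, [lam] is strictly monotone near 0, in the direction
    given by the sign. *)
Lemma relaxation_criterion_pos : 0 < lam 0 ->
  (negative_right_derivative_at0 (relaxation_time lam) <->
     n%:R^-1 * dot ones (vs 0) ^+ 2 < lam 0 * dot (vs 0) (vs 0)) /\
  (n%:R^-1 * dot ones (vs 0) ^+ 2 <> lam 0 * dot (vs 0) (vs 0) ->
     (decreasing_near0 (relaxation_time lam) <->
        n%:R^-1 * dot ones (vs 0) ^+ 2 < lam 0 * dot (vs 0) (vs 0))).
Proof.
move=> l0; rewrite -subr_lt0 -num_sqrE.
have l_lt1 : lam 0 < 1.
  by rewrite (le_lt_trans (ler_norm _)) ?dominant0_norm_lt1.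
have l_pos : \forall a \near F, 0 < lam a by exact: cvgr_gt lam_cvg _ l0.
have l_lt : \forall a \near F, lam a < 1 by exact: cvgr_lt lam_cvg _ l_lt1.
have [e2 e2_gt0 small] := F_eps (filterI l_pos l_lt).
have relaxE a : 0 < lam a -> relaxation_time lam a = (1 - lam a)^-1.
  by move=> la; rewrite /relaxation_time /spectral_gap gtr0_norm.
have gap0 : 1 - lam 0 != 0 by rewrite subr_eq0 gt_eqF.
have deriv : (relaxation_time lam a - relaxation_time lam 0) / a
    @[a --> 0^'+] --> slope / ((1 - lam 0) * (1 - lam 0)).
  have gap_cvg : (1 - lam a) * (1 - lam 0) @[a --> 0^'+] -->
      (1 - lam 0) * (1 - lam 0).
    apply: cvgM; last exact: cvg_cst.
    by apply: cvgB; [exact: cvg_cst | exact: lam_cvg_right].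
  apply: (@cvg_trans _ ((fun a => (lam a - lam 0) / a /
      ((1 - lam a) * (1 - lam 0))) @ 0^'+)); last first.
    exact: cvgM slope_cvg (cvgV (mulf_neq0 gap0 gap0) gap_cvg).
  apply: near_eq_cvg; near=> a.
  have a0 : 0 < a by near: a; exact: nbhs_right_gt.
  have [la la1] : 0 < lam a /\ lam a < 1.
    by apply: small; [exact: ltW | near: a; exact: nbhs_right_lt].
  rewrite !relaxE //.
  have gapa : 1 - lam a != 0 by rewrite subr_eq0 gt_eqF.
  by field; rewrite gap0 gapa gt_eqF.
split.
  rewrite -slope_sign.
  have gap2 : 0 < (1 - lam 0) * (1 - lam 0).
    by rewrite -expr2 exprn_even_gt0.
  have signE : (slope / ((1 - lam 0) * (1 - lam 0)) < 0) = (slope < 0).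
    by rewrite pmulr_llt0 // invr_gt0.
  split=> [[t t0 tlim]|s0]; last by eexists; [|exact: deriv]; rewrite signE.
  by rewrite -signE -(cvg_unique (@Rhausdorff R) tlim deriv).
move=> ne.
have num0 : slope_num != 0 by rewrite num_sqrE subr_eq0; apply/eqP.
have [e1 e1_gt0 mono] := lam_monotone num0.
have relax_lt a b : 0 <= a -> a < b -> b < e2 ->
    (relaxation_time lam b < relaxation_time lam a) = (lam b < lam a).
  move=> a0 ab be.
  have [la la1] := small a a0 (lt_trans ab be).
  have [lb lb1] := small b (le_trans a0 (ltW ab)) be.
  by rewrite !relaxE // ltf_pV2 ?posrE ?subr_gt0 // ltrD2l ltrN2.
split=> [[e3 e3_gt0 dec]|num_lt0].
  (* Comparing the parameters 0 and [e / 2] is enough to decide the sign of the numerator. *)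
  pose e := Num.min e1 (Num.min e2 e3).
  have e0 : 0 < e by rewrite !lt_min e1_gt0 e2_gt0.
  have h0 : 0 < e / 2 by rewrite divr_gt0.
  have : e / 2 < e by rewrite ltr_pdivrMr // ltr_pMr // ltr1n.
  rewrite {2}/e !lt_min => /and3P[h1 h2 h3].
  have := dec 0 _ (lexx 0) h0 h3; rewrite relax_lt // => lh.
  by have := mono 0 _ (lexx 0) h0 h1; rewrite nmulr_rgt0 // subr_lt0.
exists (Num.min e1 e2); first by rewrite lt_min e1_gt0.
move=> a b a0 ab; rewrite lt_min => /andP[b1 b2]; rewrite relax_lt //.
by have := mono a b a0 ab b1; rewrite nmulr_lgt0 // subr_lt0.
Unshelve. all: by end_near. Qed.

End ContinuousBranch.

(** * Convergence of the eigenvalue and of rescaled eigenvectors in the nondegenerate case *)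

Section NondegenerateBranch.
Context {R : realType} {n : nat} (A : 'M[R]_n).
Context (lam : R -> R) (vs : R -> 'cV[R]_n).
Hypothesis hA : connected_weighted_graph A.
Hypothesis hlam : dominant_eigenpairs A lam vs.
Hypothesis hnd : Defs.nondegenerate (walk_mx A) (lam 0).

Let n_gt1 : (1 < n)%N. Proof. exact: dominant_eigenpairs_order hA _ _ hlam. Qed.

Let symA : A^T = A. Proof. by case: hA. Qed.

Let deg_unit a : 0 <= a -> jump_deg A a \in unitmx.
Proof. by move=> a0; rewrite (jump_deg_unit hA) ?n_gt1. Qed.

Let c : 'cV[R]_n := jump_deg A 0 *m vs 0.
(** The squared length of [vs 0] in the inner product of the degree matrix. *)
Let k : R := dot c (vs 0).
Let bordered a x : 'M[R]_n := pencil A a x + c *m c^T.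

Let k_gt0 : 0 < k.
Proof. by rewrite /k dotC; exact: slope_den_gt0 hA hlam. Qed.

Let mx_cvg_bordered {T} {F : set_system T} {FF : Filter F} (f g : T -> R) a x :
  f t @[t --> F] --> a -> g t @[t --> F] --> x ->
  mx_cvg F (fun t => bordered (f t) (g t)) (bordered a x).
Proof.
by move=> fa gx; apply: mx_cvgD; [exact: mx_cvg_pencil | exact: mx_cvg_cst].
Qed.

Let bordered0_neq0 : \det (bordered 0 (lam 0)) != 0.
Proof.
have [v0 p0] := dominant_pencil hA hlam (lexx 0).
apply: (det_add_kernel_rank1_neq0 p0); first by rewrite gt_eqF // -/(dot _ _).
apply: (pencil_line symA (deg_unit (lexx 0)) v0 p0).
by rewrite jump_walk_mx0; case: hnd.
Qed.

(** By [det_pencil_factor], the determinant at parameter 0 changes sign at [lam 0]. The opposite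
    signs at two fixed points around [lam 0] survive for small [a], and the intermediate value
    theorem gives a root between them. *)
Lemma eigenvalue_persists (d : R) : 0 < d -> \forall a \near 0^'+,
  exists2 mu, `|mu - lam 0| < d & \det (pencil A a mu) = 0.
Proof.
move=> d0; have [_ p0] := dominant_pencil hA hlam (lexx 0).
have bordered_sign : \forall x \near lam 0,
    0 < \det (bordered 0 x) * \det (bordered 0 (lam 0)).
  have lim : \det (bordered 0 x) * \det (bordered 0 (lam 0)) @[x --> lam 0] -->
      \det (bordered 0 (lam 0)) * \det (bordered 0 (lam 0)).
    apply: cvgM; last exact: cvg_cst.
    by apply: cvg_det; apply: mx_cvg_bordered; [exact: cvg_cst | exact: cvg_id].
  by apply: cvgr_gt lim _ _; rewrite -expr2 exprn_even_gt0.
have [e /= e0 eP] : exists2 e : R, 0 < e & forall x, `|x - lam 0| < e ->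
    0 < \det (bordered 0 x) * \det (bordered 0 (lam 0)).
  by move/nbhs_ballP: bordered_sign => [e e0 eP]; exists e => // x xe;
     apply: eP; rewrite /ball /= distrC.
(* Below [d] for the required distance, below [e] so that the bordered determinant keeps its sign,
   below [k] so that [lam 0 - x + k] is positive at both ends. *)
pose r := Num.min (Num.min d e) k / 2.
have m0 : 0 < Num.min (Num.min d e) k by rewrite !lt_min d0 e0 k_gt0.
have r0 : 0 < r by rewrite divr_gt0.
have : r < Num.min (Num.min d e) k.
  by rewrite /r ltr_pdivrMr // ltr_pMr // ltr1n.
rewrite !lt_min => /andP[/andP[rd re] rk].
pose f a x := \det (pencil A a x).
have f_cvg x : f a x @[a --> 0^'+] --> f 0 x.
  apply: cvg_det; apply: mx_cvg_pencil; last exact: cvg_cst.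
  by apply: cvg_at_right_filter; exact: cvg_id.
have sign0 : f 0 (lam 0 - r) * f 0 (lam 0 + r) < 0.
  have fE x : lam 0 - x + k != 0 ->
      f 0 x * (lam 0 - x + k) = \det (bordered 0 x) * (lam 0 - x).
    exact: det_pencil_factor p0.
  have xm : lam 0 - (lam 0 - r) = r by ring.
  have xp : lam 0 - (lam 0 + r) = - r by ring.
  have kr : 0 < k - r by rewrite subr_gt0.
  have Em := fE (lam 0 - r); have Ep := fE (lam 0 + r).
  rewrite xm in Em; rewrite xp in Ep.
  have {}Em := Em (lt0r_neq0 (addr_gt0 r0 k_gt0)).
  have {}Ep : f 0 (lam 0 + r) * (- r + k) = \det (bordered 0 (lam 0 + r)) * - r.
    by apply: Ep; rewrite addrC gt_eqF.
  have Bm : 0 < \det (bordered 0 (lam 0 - r)) * \det (bordered 0 (lam 0)).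
    by apply: eP; rewrite addrAC subrr add0r normrN gtr0_norm.
  have Bp : 0 < \det (bordered 0 (lam 0 + r)) * \det (bordered 0 (lam 0)).
    by apply: eP; rewrite addrAC subrr add0r gtr0_norm.
  have BB : 0 < \det (bordered 0 (lam 0 - r)) * \det (bordered 0 (lam 0 + r)).
    have := mulr_gt0 Bm Bp; rewrite mulrACA -expr2 pmulr_lgt0 //.
    by rewrite exprn_even_gt0.
  have rk0 : 0 < (r + k) * (- r + k).
    by apply: mulr_gt0; [exact: addr_gt0 | rewrite addrC].
  rewrite -(pmulr_llt0 _ rk0) mulrACA Em Ep mulrACA pmulr_rlt0 //.
  by rewrite mulrN oppr_lt0 mulr_gt0.
have sign_near : \forall a \near 0^'+, f a (lam 0 - r) * f a (lam 0 + r) < 0.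
  by apply: cvgr_lt (cvgM (f_cvg _) (f_cvg _)) _ sign0.
near=> a.
have sa : f a (lam 0 - r) * f a (lam 0 + r) < 0 by near: a.
have [|||x xI fx] := @IVT R (f a) (lam 0 - r) (lam 0 + r) 0.
- by rewrite lerD2l ge0_cp ?ltW.
- apply: continuous_subspaceT => x.
  by apply: cvg_det; apply: mx_cvg_pencil; [exact: cvg_cst | exact: cvg_id].
- rewrite ge_min le_max; apply/andP; split; apply/orP.
    case: leP => fm; [by left | right].
    by move: sa; rewrite pmulr_rlt0 // => /ltW.
  case: leP => fm; [by left | right].
  by move: sa; rewrite nmulr_rlt0 // => /ltW.
exists x => //; rewrite (le_lt_trans _ rd) //.
by rewrite ler_distl; move: xI; rewrite in_itv.
Unshelve. all: by end_near. Qed.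

Lemma dominant_norm_liminf (e : R) : 0 < e ->
  \forall a \near 0^'+, `|lam 0| - e <= `|lam a|.
Proof.
move=> e0; have l1 := dominant0_norm_lt1 hA hlam.
(* The second bound keeps the persisting eigenvalue inside the open unit interval, so it is neither
   1 nor -1 and competes with [lam a]. *)
have d0 : 0 < Num.min e (1 - `|lam 0|) by rewrite lt_min e0 subr_gt0.
have := eigenvalue_persists d0; apply: filter_app; near=> a.
move=> [mu]; rewrite lt_min => /andP[mue mu1] pmu.
have a0 : 0 <= a by near: a; exact: nbhs_right_ge.
have mu_lt1 : `|mu| < 1.
  rewrite -(subrK (lam 0) mu) (le_lt_trans (ler_normD _ _)) //.
  by rewrite -ltrBrDr.
have [[_ _ _ le_lam] _] := hlam a0.
move: (le_lam mu); rewrite eigenvalue_pencil ?deg_unit // pmu eqxx.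
move=> /(_ isT) mu_le.
apply: le_trans (mu_le _ _).
- rewrite lerBlDr -lerBlDl (le_trans (lerB_dist _ _)) // distrC; exact: ltW.
- by apply: contraTneq mu_lt1 => ->; rewrite normr1 ltxx.
- by apply: contraTneq mu_lt1 => ->; rewrite normrN1 ltxx.
Unshelve. all: by end_near. Qed.

(** A nonzero determinant at [(0, nu)] would stay nonzero nearby, yet clustering supplies points
    [(a, lam a)] there with [a > 0]. *)
Let cluster_singular (G : R -> R -> 'M[R]_n) (nu : R) :
    cluster (lam a @[a --> 0^'+]) nu ->
    mx_cvg (filter_prod 0^'+ (nbhs nu)) (fun p => G p.1 p.2) (G 0 nu) ->
    (forall a, 0 < a -> \det (G a (lam a)) = 0) ->
  \det (G 0 nu) = 0.
Proof.
move=> cl Gcvg sing; apply/eqP; apply/negP => /negP nz.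
have [[U V] /= [FU nV] UV] : \forall p \near filter_prod 0^'+ (nbhs nu),
    \det (G p.1 p.2) != 0 by exact: cvgr_neq0 (cvg_det Gcvg) nz.
pose W := [set lam a | a in [set a | U a /\ 0 < a]].
have FW : (lam a @[a --> 0^'+]) W.
  have : \forall a \near 0^'+, W (lam a); last by [].
  near=> a; exists a => //; split; first by near: a.
  by near: a; exact: nbhs_right_gt.
have [x [[a [Ua a0] <-] Vx]] := cl W V FW nV.
by have := UV (a, lam a) (conj Ua Vx); rewrite /= sing ?eqxx.
Unshelve. all: by end_near. Qed.

(** The value [nu] is an eigenvalue of the walk, differs from 1 and has modulus at least that of
    [lam 0]; nondegeneracy leaves only [lam 0]. *)
Let cluster_unique (nu : R) : cluster (lam a @[a --> 0^'+]) nu -> nu = lam 0.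
Proof.
move=> cl.
have fst0 : p.1 @[p --> filter_prod 0^'+ (nbhs nu)] --> (0 : R).
  apply: (@cvg_trans _ (0 : R)^'+); first exact: cvg_fst.
  by apply: cvg_at_right_filter; exact: cvg_id.
have sndnu : p.2 @[p --> filter_prod (0 : R)^'+ (nbhs nu)] --> nu.
  exact: cvg_snd.
have sing : \det (pencil A 0 nu) = 0.
  apply: (cluster_singular cl); first exact: mx_cvg_pencil.
  move=> a /ltW a0; apply/eqP; rewrite -eigenvalue_pencil ?deg_unit //.
  by have [[]] := hlam a0.
have nu1 : nu != 1.
  (* Since [lam a != 1], [vs a] is orthogonal to [h a] and remains in the kernel after bordering by
     [h a]. The limit would then be singular, but bordering at the eigenvalue 1 is invertible
     because harmonic vectors are constant. *)
  apply/eqP => nu1; pose h a : 'cV[R]_n := jump_deg A a *m ones.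
  have n0 : (0 < n)%N := ltnW n_gt1.
  have ones0 : (ones : 'cV[R]_n) != 0.
    apply/eqP => /matrixP/(_ (Ordinal n0) 0)/eqP.
    by rewrite !mxE oner_eq0.
  have : \det (pencil A 0 nu + h 0 *m (h 0)^T) = 0.
    apply: (@cluster_singular (fun a x => pencil A a x + h a *m (h a)^T) _ cl).
      have h_cvg : mx_cvg (filter_prod 0^'+ (nbhs nu)) (fun p => h p.1) (h 0).
        by apply: mx_cvgM; [exact: mx_cvg_jump_deg | exact: mx_cvg_cst].
      apply: mx_cvgD; first exact: mx_cvg_pencil.
      by apply: mx_cvgM => //; exact: mx_cvg_tr.
    move=> a /ltW a0; have [va pa] := dominant_pencil hA hlam a0.
    have hv : dot (h a) (vs a) = 0.
      have := pencil_two_point symA (pencil_ones A a n0) pa.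
      rewrite subrr mul0r => /eqP; rewrite mulf_eq0 subr_eq0.
      have [[_ /negPf -> _ _] _] := hlam a0.
      by rewrite /= -(dot_mul_sym _ _ (tr_jump_deg A a)) => /eqP.
    apply/eqP; rewrite -det_tr; apply/det0P; exists (vs a)^T.
      by apply: contra va => /eqP/(congr1 trmx); rewrite trmxK trmx0 => ->.
    rewrite -trmx_mul mulmxDl pa add0r -mulmxA [_^T *m _]mx11_scalar.
    by rewrite -/(dot _ _) hv raddf0 mulmx0 trmx0.
  apply/eqP; rewrite nu1.
  apply: (det_add_kernel_rank1_neq0 (pencil_ones A 0 n0)).
    rewrite -/(dot _ _) dotC gt_eqF //.
    by apply: (dot_jump_deg_gt0 hA) => //; rewrite n_gt1.
  move=> u up; exists (u^T (Ordinal n0) 0); rewrite -[u in LHS]trmxK.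
  rewrite {1}(harmonic_constant hA (v := u^T) (Ordinal n0)) ?linearZ //.
  by rewrite -(tr_pencil 0 1 symA) -trmx_mul up trmx0.
have nu_ge : `|lam 0| <= `|nu|.
  rewrite leNgt; apply/negP => nu_lt.
  pose e := (`|lam 0| - `|nu|) / 2.
  have e0 : 0 < e by rewrite divr_gt0 // subr_gt0.
  have nuV : \forall x \near nu, `|x| < `|lam 0| - e.
    have nue : `|nu| < `|lam 0| - e by rewrite /e; lra.
    exact: (@cvgr_norm_lt _ _ _ (nbhs nu) _ id nu cvg_id _ nue).
  have [x [/= + Vx]] := cl [set x | `|lam 0| - e <= `|x|] _
    (dominant_norm_liminf e0) nuV.
  by rewrite leNgt Vx.
have enu : eigenvalue (walk_mx A) nu.
  by rewrite -jump_walk_mx0 eigenvalue_pencil ?deg_unit // sing eqxx.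
have [nm1 uniq _] := hnd.
have num1 : nu != -1 by apply: contraNneq nm1 => <-.
apply: uniq => //; apply/eqP; rewrite eq_le nu_ge andbT.
by have [[_ _ _ le0] _] := hlam (lexx 0); apply: le0; rewrite ?jump_walk_mx0.
Qed.

(** In a compact set, a filter with a single cluster point converges to it. The interval [[-2, 2]]
    also contains the unit ball around [lam 0], so it is a neighbourhood of the limit. *)
Lemma nondegenerate_lam_cvg : lam a @[a --> 0^'+] --> lam 0.
Proof.
have l1 := dominant0_norm_lt1 hA hlam.
have bnd : (lam a @[a --> 0^'+]) `[- 2, 2]%classic.
  have : \forall a \near 0^'+, `[- 2, 2]%classic (lam a); last by [].
  near=> a; have a0 : 0 <= a by near: a; exact: nbhs_right_ge.
  rewrite /= in_itv /= -ler_norml.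
  by rewrite (le_trans (dominant_norm_le1 hA hlam a0)) ?ler1n.
apply: (compact_cluster_set1 _ (@segment_compact R (-2) 2) _ _ bnd).
- exact: Rhausdorff.
- apply/nbhs_ballP; exists 1 => //= x; rewrite /ball /= in_itv /= -ler_norml.
  rewrite distrC => lx; rewrite -(subrK (lam 0) x).
  by rewrite (le_trans (ler_normD _ _)) //; lra.
- apply/seteqP; split => [x /= /cluster_unique //|_ /= ->].
  have [p [_ cp]] := @segment_compact R (-2) 2 _ _ bnd.
  by rewrite -(cluster_unique cp).
Unshelve. all: by end_near. Qed.

(** Normalized to have the same pairing with [c] as [vs 0]. The default factor 1 keeps the vector
    nonzero when the pairing vanishes, which does not happen near 0. *)
Definition rescaled a : 'cV[R]_n :=
  (if dot c (vs a) == 0 then 1 else k / dot c (vs a)) *: vs a.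

Lemma rescaled0 : rescaled 0 = vs 0.
Proof.
by rewrite /rescaled -/k gt_eqF // divff ?scale1r // gt_eqF.
Qed.

Lemma rescaled_dominant : dominant_eigenpairs A lam rescaled.
Proof.
move=> a a0; have [dom [v0 ev]] := hlam a0; split=> //; split.
  rewrite scaler_eq0 negb_or v0 andbT; case: ifPn => [_|nz].
    exact: oner_neq0.
  by rewrite mulf_neq0 ?invr_eq0 // gt_eqF.
by rewrite -scalemxAr ev scalerA mulrC -scalerA.
Qed.

(** Near 0 the rescaled vector is the unique solution of [B a *m v = k *: c], and Cramer's rule
    expresses it continuously in [B a]. *)
Lemma rescaled_cvg : mx_cvg 0^'+ rescaled (rescaled 0).
Proof.
pose B a := bordered a (lam a).
have B_cvg : mx_cvg 0^'+ B (B 0).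
  apply: mx_cvg_bordered; last exact: nondegenerate_lam_cvg.
  by apply: cvg_at_right_filter; exact: cvg_id.
have det_cvg : \det (B a) @[a --> 0^'+] --> \det (B 0) by exact: cvg_det.
have det_nz : \forall a \near 0^'+, \det (B a) != 0.
  exact: cvgr_neq0 det_cvg bordered0_neq0.
pose w a := (k / \det (B a)) *: (\adj (B a) *m c).
have solve a v : \det (B a) != 0 -> B a *m v = k *: c -> v = w a.
  move=> nz Bv; rewrite /w mulrC -scalerA scalemxAr -Bv mulmxA mul_adj_mx.
  by rewrite mul_scalar_mx scalerA mulVf // scale1r.
have Bvs a : 0 <= a -> B a *m vs a = dot c (vs a) *: c.
  move=> a0; have [_ pa] := dominant_pencil hA hlam a0.
  rewrite mulmxDl pa add0r -mulmxA [c^T *m _]mx11_scalar.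
  by rewrite mul_mx_scalar.
have w_cvg : mx_cvg 0^'+ w (w 0).
  apply: mx_cvgZ; last first.
    by apply: mx_cvgM; [exact: mx_cvg_adj | exact: mx_cvg_cst].
  apply: cvgM; first exact: cvg_cst.
  exact: cvgV bordered0_neq0 det_cvg.
have w0 : w 0 = rescaled 0.
  by rewrite rescaled0; apply/esym/solve => //; exact: Bvs.
move=> i j; rewrite -w0; apply: cvg_trans (w_cvg i j); apply: near_eq_cvg.
near=> a.
have a0 : 0 <= a by near: a; exact: nbhs_right_ge.
have nz : \det (B a) != 0 by near: a.
(* Otherwise [vs a] would be a kernel vector of the invertible [B a]. *)
have dnz : dot c (vs a) != 0.
  apply: contra nz => /eqP d0; have := Bvs a a0; rewrite d0 scale0r => Bv.
  have [v0 _] := dominant_pencil hA hlam a0.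
  rewrite -det_tr; apply/det0P; exists (vs a)^T.
    by apply: contra v0 => /eqP/(congr1 trmx); rewrite trmxK trmx0 => ->.
  by rewrite -trmx_mul Bv trmx0.
suff -> : rescaled a = w a by [].
apply: solve => //.
by rewrite /rescaled (negPf dnz) -scalemxAr Bvs // scalerA divfK.
Unshelve. all: by end_near. Qed.

End NondegenerateBranch.

(* When the two sides of the criterion are equal, the relaxation time is stationary
   at 0 to first order, and may still decrease through higher-order terms; hence
   the two forms of the criterion for 0 < lam 0. *)
Theorem theorem1 (R : realType) (n : nat) (A : 'M[R]_n)
    (lam : R -> R) (vs : R -> 'cV[R]_n)
    (hA : connected_weighted_graph A)
    (hlam : dominant_eigenpairs A lam vs)
    (hreg : regular_at0 A lam vs) :
  [/\ lam 0 < 0 ->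
        increasing_near0 (spectral_gap lam) /\
        decreasing_near0 (relaxation_time lam),
      0 < lam 0 ->
        (negative_right_derivative_at0 (relaxation_time lam) <->
           n%:R^-1 * dot ones (vs 0) ^+ 2 < lam 0 * dot (vs 0) (vs 0)) /\
        (n%:R^-1 * dot ones (vs 0) ^+ 2 <> lam 0 * dot (vs 0) (vs 0) ->
           (decreasing_near0 (relaxation_time lam) <->
              n%:R^-1 * dot ones (vs 0) ^+ 2 < lam 0 * dot (vs 0) (vs 0))) &
      (fun a : R => lam a - (lam 0 + a *
         ((n%:R^-1 * (dot (vs 0) ones * dot ones (vs 0))
             - lam 0 * dot (vs 0) (vs 0))
          / dot (vs 0) (degree_mx A *m vs 0))))
        =O_ (0^'+) (fun a : R => a ^+ 2)].
Proof.
(* The conclusion involves [vs] only through [vs 0], which rescaling preserves, so a convergent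
   choice of eigenvectors may be assumed. *)
wlog vs_cvg : vs hlam hreg / mx_cvg 0^'+ vs (vs 0) => [wl|].
  case: (hreg) => [hnd|vs_cvg]; last first.
    apply: wl => // i j.
    apply: (cvg_comp vs (fun v : 'cV[R]_n => v i j) vs_cvg).
    exact: coord_continuous.
  rewrite -(rescaled0 hA hlam); apply: wl.
  - exact: rescaled_dominant.
  - by left.
  - exact: (rescaled_cvg hA hlam hnd).
split; first exact: (gap_increasing_neg hA hlam vs_cvg).
  exact: (relaxation_criterion_pos hA hlam vs_cvg).
have [k k_gt0 lam_le] := lam_second_order hA hlam vs_cvg.
by apply/eqO_exP; exists k.
Qed.
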